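(* Let $A\in\mathbb{R}^{m\times n}$, $1\le k\le l\le l'$ with $l\le n$, $l'\le m$. Let $U=L'U'\in\mathbb{R}^{m\times m}$ and $V=V'R'\in\mathbb{R}^{n\times n}$ be invertible matrices structured as in the context, let $AV=QR$ be a QR factorization with $Q\in\mathbb{R}^{m\times m}$ orthogonal and $R\in\mathbb{R}^{m\times n}$ upper triangular, and let $\bar A=UAV$, blocked so that $\bar A_{11}$ is $l'\times l$; assume $\bar A_{11}$ has full column rank. Block $R$ so that $R_{11}$ is $l\times l$, and $Q$ and $UQ$ so that $Q_{11}$ and $(UQ)_{11}$ are $l'\times l$. Then the low-rank approximation $$A_k:=U^{-1}\begin{pmatrix} I_{l'}\\ \bar A_{21}\bar A_{11}^+\end{pmatrix}\begin{pmatrix}\bar A_{11}&\bar A_{12}\end{pmatrix}V^{-1}$$ satisfies, for $1\le j\le\min(m,n)-k$ and $1\le i\le k$: $$\|A-A_k\|_F^2\le\|R_{22}\|_F^2+\|(UQ)_{11}^+(UQ)_{12}R_{22}\|_F^2,$$ $$\|(A-A_k)-(A-A_k)_{\mathrm{opt},j-1}\|_F^2\le\|R_{22}-(R_{22})_{\mathrm{opt},j-1}\|_F^2+\|(UQ)_{11}^+(UQ)_{12}(R_{22}-(R_{22})_{\mathrm{opt},j-1})\|_F^2,$$ $$\|A-A_k\|_2^2\le\|R_{22}\|_2^2+\|(UQ)_{11}^+(UQ)_{12}R_{22}\|_2^2,$$ $$\sigma_j^2(A-A_k)\le\|R_{22}-(R_{22})_{\mathrm{opt},j-1}\|_2^2+\|(UQ)_{11}^+(UQ)_{12}(R_{22}-(R_{22})_{\mathrm{opt},j-1})\|_2^2,$$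 $$\sigma_i(A_k)\ \ge\ \sigma_i\big(A_k[:,:l']\big)\ =\ \sigma_i\big(R_{11}R_{11}'^{-1}\big).$$ (The numbers $\sigma_j(R_{11}R_{11}'^{-1})$ could be thought of as the singular values of $A$ restricted to $\mathrm{im}(AV_1)$, where $V_1$ is the first $l$ columns of $V$.)
   Context: Singular values are in decreasing order (and are $0$ beyond the matrix dimensions); $X^+$ is the Moore–Penrose pseudo-inverse, and $X_{11}^+$ means $(X_{11})^+$; $X_{\mathrm{opt},r}$ is the rank-$r$ truncated SVD of $X$ (for $r=0$ it is $0$; for $r\ge\operatorname{rank}X$ it is $X$). $X[:,:p]$ denotes the first $p$ columns of $X$. Structure of $U$: $U=L'U'$ with $U'$ an $m\times m$ orthogonal matrix and $L'=\begin{pmatrix}L'_{11}&0\\0&I_{m-l'}\end{pmatrix}$, $L'_{11}$ an invertible $l'\times l'$ lower triangular matrix. Structure of $V$: $V=V'R'$ with $V'$ an $n\times n$ orthogonal matrix and $R'=\begin{pmatrix}R'_{11}&0\\0&I_{n-l}\end{pmatrix}$, $R'_{11}$ an invertible $l\times l$ upper triangular matrix. Blocks: $\bar A=\begin{pmatrix}\bar A_{11}&\bar A_{12}\\\bar A_{21}&\bar A_{22}\end{pmatrix}$ with $\bar A_{11}$ of size $l'\times l$; $R=\begin{pmatrix}R_{11}&R_{12}\\0&R_{22}\end{pmatrix}$ with $R_{11}$ of size $l\times l$ and $R_{22}$ of size $(m-l)\times(n-l)$; $UQ$ is $m\times m$ with $(UQ)_{11}$ of size $l'\times l$ and $(UQ)_{12}$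 of size $l'\times(m-l)$.
   Formalization: The printed equality σ_i(A_k[:,:l']) = σ_i(R11 R'11^{-1}) is false (e.g. V' a swap); it is proved instead for the first l columns of A_k V', whose σ_i are also shown to be ≤ σ_i(A_k); σ_i(A_k) ≥ σ_i(A_k[:,:l']) is kept. *)

(* Defs.v *)
From HB Require Import structures.
From mathcomp Require Import all_boot all_order all_algebra.
From mathcomp Require Import all_classical all_reals.

Set Implicit Arguments.
Unset Strict Implicit.
Unset Printing Implicit Defensive.

Import Order.TTheory GRing.Theory Num.Theory.
Local Open Scope classical_set_scope.
Local Open Scope ring_scope.

Section Matrices.
Variable K : realType.

(* Two-sided inverse: for a square matrix this one equation is enough. *)
Definition orthogonal_mx n (X : 'M[K]_n) : Prop := X^T *m X = 1%:M.

Definition frobenius_norm m n (X : 'M[K]_(m, n)) : K :=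
  Num.sqrt (\sum_i \sum_j X i j ^+ 2).

(* On a column vector the Frobenius norm is the Euclidean norm. *)
Definition spectral_norm m n (X : 'M[K]_(m, n)) : K :=
  sup [set frobenius_norm (X *m v) |
        v in [set v : 'cV[K]_n | frobenius_norm v <= 1]].

(* The four Penrose equations. MathComp's [pinvmx] is only a partial inverse
   and is not the Moore-Penrose pseudo-inverse. *)
Definition is_moore_penrose m n (X : 'M[K]_(m, n)) (Y : 'M[K]_(n, m)) : Prop :=
  [/\ X *m Y *m X = X, Y *m X *m Y = Y,
      (X *m Y)^T = X *m Y & (Y *m X)^T = Y *m X].

Definition moore_penrose m n (X : 'M[K]_(m, n)) : 'M[K]_(n, m) :=
  xget 0 [set Y | is_moore_penrose X Y].

(* m x n, with s 0, ..., s (r - 1) on the main diagonal. *)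
Definition rect_diag m n (s : nat -> K) (r : nat) : 'M[K]_(m, n) :=
  \matrix_(i < m, j < n) if ((i : nat) == j) && (i < r)%N then s i else 0.

(* The sequence s is indexed from 0 and padded by 0 beyond the matrix
   dimensions, hence determined by X. *)
Definition is_svd m n (X : 'M[K]_(m, n))
    (P : 'M[K]_m) (s : nat -> K) (W : 'M[K]_n) : Prop :=
  [/\ orthogonal_mx P, orthogonal_mx W,
      (forall i, 0 <= s i) /\ (forall i j, (i <= j)%N -> s j <= s i),
      (forall i, (minn m n <= i)%N -> s i = 0)
    & X = P *m rect_diag m n s (minn m n) *m W^T].

(* [singular_value i X] is sigma_i(X), indexed from i = 1. *)
Definition singular_value (i : nat) m n (X : 'M[K]_(m, n)) : K :=
  xget (fun=> 0) [set s : nat -> K | exists P W, is_svd X P s W] i.-1.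

(* Y is a rank-r truncated SVD X_{opt,r} of X. This is a relation because
   X_{opt,r} depends on the chosen SVD when sigma_r(X) = sigma_{r+1}(X). *)
Definition truncated_svd (r : nat) m n (X Y : 'M[K]_(m, n)) : Prop :=
  exists P s W, is_svd X P s W /\ Y = P *m rect_diag m n s r *m W^T.

(* X[:, :p]; this is X itself when p >= n. *)
Definition first_cols (p : nat) m n (X : 'M[K]_(m, n)) : 'M[K]_(m, minn p n) :=
  colsub (widen_ord (geq_minr p n)) X.

(* [split_mx hp hq X] is X with its dimensions cast so that
   [ulsubmx], [ursubmx], [dlsubmx], [drsubmx] give the 2 x 2 blocking
   with leading block of size p x q; [join_mx] casts back. *)
Definition split_mx p q m n (hp : (p <= m)%N) (hq : (q <= n)%N)
    (X : 'M[K]_(m, n)) : 'M[K]_(p + (m - p), q + (n - q)) :=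
  castmx (esym (subnKC hp), esym (subnKC hq)) X.

Definition join_mx p q m n (hp : (p <= m)%N) (hq : (q <= n)%N)
    (X : 'M[K]_(p + (m - p), q + (n - q))) : 'M[K]_(m, n) :=
  castmx (subnKC hp, subnKC hq) X.

(* diag(X, I_{n-p}), of size n x n. *)
Definition extend_id p n (hp : (p <= n)%N) (X : 'M[K]_p) : 'M[K]_n :=
  join_mx hp hp (block_mx X 0 0 1%:M).

End Matrices.

(* Main.v *)
Require Import Defs.
From HB Require Import structures.
From mathcomp Require Import all_boot all_order all_algebra.
From mathcomp Require Import all_classical all_reals.
From mathcomp Require Import topology normedtype derive.
From mathcomp Require Import ring lra zify.

Set Implicit Arguments.
Unset Strict Implicit.
Unset Printing Implicit Defensive.

Import Order.TTheory GRing.Theory Num.Theory.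
Import numFieldNormedType.Exports.
Local Open Scope ring_scope.

(** Write Y = R22 and W = (UQ)11^+ (UQ)12. The whole proposition rests on an
exact formula for the error. Since U A V = (U Q) R with R block upper triangular, full
column rank of Abar11 = (UQ)11 R11 makes R11 invertible, and the factor R11
cancels from Abar21 Abar11^+ = (UQ)21 (UQ)11^+. Subtracting the approximation
from U A V therefore clears every block but the last one, where
((UQ)22 - (UQ)21 W) Y is left ([residual_block]). Matrices supported on the last
block do not see the identity-extended triangular factors of U and V, so
A - Ak = P (S Y) N^T, where S = (UQ)22 - (UQ)21 W and P, N have orthonormal
columns.

Moreover S Z is the lower block row of U Q applied to the column (- W Z, Z). That
block row is made of rows of the orthogonal matrix U' Q, hence does not increase
norms: |S Z|^2 <= |Z|^2 + |W Z|^2 for all Z ([schur_compl_sqn_le]). With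
Z = Y this is the Frobenius bound; with Z = Y x for vectors x it is the spectral
bound. If Yopt has rank at most j - 1, so has P (S Yopt) N^T, and it differs from
A - Ak by P (S (Y - Yopt)) N^T; the optimality of truncated singular value
decompositions, in the Frobenius norm ([frobenius_truncated_optimal]) and in the
spectral norm ([svd_le_of_rank]), then gives the two bounds that involve j.

For the singular values of Ak: multiplication by matrices of norm at most 1 on
either side cannot increase singular values ([singular_value_contraction]).
Selecting columns is such a multiplication. As A - Ak vanishes on the first l
columns of V', the first l columns of Ak V' are those of A V', namely
Q (R11 R'11^-1 ; 0), and this matrix and R11 R'11^-1 are obtained from each other
by such multiplications.

All of this needs the existence of singular value decompositions ([svd_exists]),
proved by splitting off a unit vector of maximal image norm, which exists because
the unit sphere is compact. Norms are handled through the sum of squared entries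
[sqn], which avoids square roots. *)

(** * Squared Euclidean norms and orthogonal matrices *)

Section SquaredNorm.
Variable K : realType.

Definition sqn m n (X : 'M[K]_(m, n)) : K := \sum_i \sum_j X i j ^+ 2.

Lemma sqn_ge0 m n (X : 'M[K]_(m, n)) : 0 <= sqn X.
Proof. by apply: sumr_ge0 => i _; apply: sumr_ge0 => j _; apply: sqr_ge0. Qed.

Lemma frobenius_norm_sqr m n (X : 'M[K]_(m, n)) : frobenius_norm X ^+ 2 = sqn X.
Proof. by rewrite sqr_sqrtr // sqn_ge0. Qed.

Lemma sqn_trmx m n (X : 'M[K]_(m, n)) : sqn X^T = sqn X.
Proof.
by rewrite /sqn exchange_big; do 2!apply: eq_bigr => ? _; rewrite mxE.
Qed.

Lemma sqn_tr m n (X : 'M[K]_(m, n)) : sqn X = \tr (X^T *m X).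
Proof.
rewrite -sqn_trmx; apply: eq_bigr => i _; rewrite mxE.
by apply: eq_bigr => j _; rewrite !mxE expr2.
Qed.

Lemma sqn_eq0 m n (X : 'M[K]_(m, n)) : sqn X = 0 -> X = 0.
Proof.
move=> X0; apply/matrixP => i j; rewrite mxE; apply/eqP.
have /psumr_eq0P rows0 : \sum_i \sum_j X i j ^+ 2 = 0 by [].
have /rows0 /(_ i isT) /psumr_eq0P row0 k : true -> 0 <= \sum_j X k j ^+ 2.
  by move=> _; apply: sumr_ge0 => j' _; apply: sqr_ge0.
by rewrite -sqrf_eq0; apply/eqP/row0 => // j' _; apply: sqr_ge0.
Qed.

Lemma sqn0 m n : sqn (0 : 'M[K]_(m, n)) = 0.
Proof. by rewrite sqn_tr mulmx0 mxtrace0. Qed.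

Lemma sqnZ m n a (X : 'M[K]_(m, n)) : sqn (a *: X) = a ^+ 2 * sqn X.
Proof.
rewrite /sqn mulr_sumr; apply: eq_bigr => i _; rewrite mulr_sumr.
by apply: eq_bigr => j _; rewrite mxE exprMn.
Qed.

Lemma sqnN m n (X : 'M[K]_(m, n)) : sqn (- X) = sqn X.
Proof. by rewrite -scaleN1r sqnZ sqrrN expr1n mul1r. Qed.

Lemma sqn_col_mx m1 m2 n (X : 'M[K]_(m1, n)) (Y : 'M[K]_(m2, n)) :
  sqn (col_mx X Y) = sqn X + sqn Y.
Proof. by rewrite !sqn_tr tr_col_mx mul_row_col linearD. Qed.

Lemma sqn_row_mx m n1 n2 (X : 'M[K]_(m, n1)) (Y : 'M[K]_(m, n2)) :
  sqn (row_mx X Y) = sqn X + sqn Y.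
Proof. by rewrite -sqn_trmx tr_row_mx sqn_col_mx !sqn_trmx. Qed.

Lemma sqn_scalar (x : 'M[K]_1) : sqn x = x 0 0 ^+ 2.
Proof. by rewrite /sqn !big_ord1. Qed.

Lemma sqn_mulmx_isometry m n p (P : 'M[K]_(m, n)) (X : 'M[K]_(n, p)) :
  P^T *m P = 1%:M -> sqn (P *m X) = sqn X.
Proof.
by move=> PP; rewrite !sqn_tr trmx_mul mulmxA -(mulmxA X^T) PP mulmx1.
Qed.

End SquaredNorm.

Section Orthogonal.
Variable K : realType.

Lemma orthogonal_mulmx_tr n (P : 'M[K]_n) : orthogonal_mx P -> P *m P^T = 1%:M.
Proof. exact: mulmx1C. Qed.

Lemma orthogonal_trmx n (P : 'M[K]_n) : orthogonal_mx P -> orthogonal_mx P^T.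
Proof. by move/orthogonal_mulmx_tr; rewrite /orthogonal_mx trmxK. Qed.

Lemma orthogonal_mul n (P P' : 'M[K]_n) :
  orthogonal_mx P -> orthogonal_mx P' -> orthogonal_mx (P *m P').
Proof.
rewrite /orthogonal_mx trmx_mul => PP PP'.
by rewrite mulmxA -(mulmxA P'^T) PP mulmx1.
Qed.

Lemma orthogonal1 n : orthogonal_mx (1%:M : 'M[K]_n).
Proof. by rewrite /orthogonal_mx trmx1 mulmx1. Qed.

Lemma orthogonal_block n (P : 'M[K]_n) : orthogonal_mx P ->
  orthogonal_mx (block_mx (1%:M : 'M_1) 0 0 P).
Proof.
rewrite /orthogonal_mx => PP; rewrite tr_block_mx mulmx_block !trmx0 trmx1.
by rewrite !(mul0mx, mulmx0, addr0, add0r) mulmx1 PP -scalar_mx_block.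
Qed.

Lemma sqn_orthogonall m n (P : 'M[K]_m) (X : 'M[K]_(m, n)) :
  orthogonal_mx P -> sqn (P *m X) = sqn X.
Proof. exact: sqn_mulmx_isometry. Qed.

Lemma sqn_orthogonalr m n (P : 'M[K]_n) (X : 'M[K]_(m, n)) :
  orthogonal_mx P -> sqn (X *m P) = sqn X.
Proof.
by move=> hP; rewrite -sqn_trmx trmx_mul sqn_orthogonall ?sqn_trmx //;
  apply: orthogonal_trmx.
Qed.

(** The Householder reflection exchanging the first basis vector e and v. *)
Lemma orthogonal_first_col n (v : 'cV[K]_(1 + n)) : sqn v = 1 ->
  exists2 H : 'M[K]_(1 + n), orthogonal_mx H & lsubmx H = v.
Proof.
move=> v1; pose e : 'cV[K]_(1 + n) := col_mx 1%:M 0; pose w := v - e.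
have colE (H : 'M[K]_(1 + n)) : lsubmx H = H *m e.
  by rewrite -[H in RHS]hsubmxK mul_row_col mulmx0 addr0 mulmx1.
have [w0|wN0] := eqVneq w 0.
  exists 1%:M; first exact: orthogonal1.
  by rewrite colE mul1mx; apply/esym/eqP; rewrite -subr_eq0 -/w w0.
pose d := sqn w; have dN0 : d != 0.
  by apply: contraNneq wN0 => /sqn_eq0 ->.
have wtw : w^T *m w = d%:M.
  by rewrite [LHS]mx11_scalar /d sqn_tr /mxtrace big_ord1.
(* Since e and v have equal length, w = v - e makes opposite inner products
   with them, so each is half of w^T *m w up to sign. *)
have wte : w^T *m e = (- (d / 2))%:M.
  have vtv : v^T *m v = 1%:M.
    by rewrite [LHS]mx11_scalar -v1 sqn_tr /mxtrace big_ord1.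
  have ete : e^T *m e = 1%:M.
    by rewrite tr_col_mx mul_row_col trmx1 trmx0 mulmx1 mulmx0 addr0.
  have evC : e^T *m v = v^T *m e.
    by rewrite [LHS]mx11_scalar [RHS]mx11_scalar -[v^T *m e]trmxK trmx_mul trmxK
         [in RHS]mxE.
  have : w^T *m e = (2^-1 : K) *: - (w^T *m w).
    have wT : w^T = v^T - e^T by rewrite /w linearB.
    rewrite wT /w mulmxBr !mulmxBl vtv ete evC.
    by apply/matrixP => i j; rewrite !mxE; field.
  by move=> ->; rewrite wtw; apply/matrixP => i j; rewrite !mxE; field.
pose H := 1%:M - (2 / d) *: (w *m w^T).
have HT : H^T = H.
  by rewrite /H linearB /= trmx1 linearZ /= trmx_mul trmxK.
exists H.
  rewrite /orthogonal_mx HT /H mulmxBl mul1mx mulmxBr mulmx1.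
  rewrite -scalemxAl -scalemxAr scalerA mulmxA -(mulmxA w) wtw.
  rewrite mul_mx_scalar -scalemxAl scalerA.
  move: (w *m w^T) 1%:M => W I; apply/matrixP => i j; rewrite !mxE.
  by field.
rewrite colE /H mulmxBl mul1mx -scalemxAl -mulmxA wte mul_mx_scalar scalerA.
have -> : 2 / d * - (d / 2) = -1 by field.
by rewrite scaleN1r opprK /w addrC subrK.
Qed.

End Orthogonal.

(** * Existence of the singular value decomposition *)

Section SVD.
Variable K : realType.

Lemma continuous_sum (T : topologicalType) (I : finType) (f : I -> T -> K) :
  (forall i, continuous (f i)) -> continuous (fun x => \sum_i f i x).
Proof.
move=> cf x; rewrite /continuous_at.
elim: (index_enum I) => [|i s IHs].
  rewrite big_nil (_ : (fun _ => _) = fun=> 0); first exact: cvg_cst.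
  by apply/funext => y; rewrite big_nil.
rewrite big_cons (_ : (fun _ => _) = fun y => f i y + \sum_(j <- s) f j y).
  by apply: cvgD => //; apply: cf.
by apply/funext => y; rewrite big_cons.
Qed.

Lemma sqn_mulmx_continuous n p (M : 'M[K]_(n, p)) :
  continuous (fun r : 'rV[K]_n => sqn (r *m M)).
Proof.
apply: continuous_sum => i; apply: continuous_sum => j.
have cij : continuous (fun r : 'rV[K]_n => (r *m M) i j).
  rewrite (_ : (fun _ => _) = fun r : 'rV[K]_n => \sum_k r i k * M k j).
    apply: continuous_sum => k x.
    by apply: continuousM; [exact: coord_continuous | exact: cst_continuous].
  by apply/funext => r; rewrite mxE.
rewrite (_ : (fun _ => _) =
             fun r : 'rV[K]_n => (r *m M) i j * (r *m M) i j).
  by move=> x; apply: continuousM; apply: cij.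
by apply/funext => r; rewrite expr2.
Qed.

Lemma unit_sphere_compact n : compact [set r : 'rV[K]_n | sqn r = 1].
Proof.
apply: bounded_closed_compact.
  exists 1; split => // M M1 r /= r1; apply: le_trans (ltW M1).
  rewrite [leLHS]/Num.norm /= mx_normrE.
  apply/bigmax_leP; split => // -[i j] _ /=.
  rewrite -[leRHS](ger0_norm ler01) -ler_sqr ?nnegrE // !real_normK
    ?num_real //.
  rewrite expr1n -r1 /sqn (bigD1 i) //= (bigD1 j) //= -addrA lerDl.
  by apply: addr_ge0; do ?apply: sumr_ge0 => ? _; rewrite ?sqr_ge0 //;
    apply: sumr_ge0 => ? _; rewrite sqr_ge0.
have -> : [set r : 'rV[K]_n | sqn r = 1]%classic =
          ((fun r => sqn (r *m 1%:M)) @^-1` [set x | x = 1])%classic.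
  by apply/seteqP; split => r /=; rewrite mulmx1.
apply: preimage_closed; last exact: closed_eq.
by move=> r _; apply: sqn_mulmx_continuous.
Qed.

(** By compactness, the operator norm of X is attained. *)
Lemma exists_unit_maximizer m n (X : 'M[K]_(m, 1 + n)) :
  exists2 v : 'cV[K]_(1 + n), sqn v = 1 &
    forall w : 'cV[K]_(1 + n), sqn (X *m w) <= sqn (X *m v) * sqn w.
Proof.
have S0 : ([set r : 'rV[K]_(1 + n) | sqn r = 1] !=set0)%classic.
  exists (row_mx 1%:M 0) => /=; rewrite sqn_row_mx sqn0 addr0 sqn_scalar mxE.
  by rewrite eqxx expr1n.
have [|r] := EVT_max_rV S0 (@unit_sphere_compact _)
  (f := fun r => sqn (r *m X^T)).
  by apply: continuous_subspaceT; apply: sqn_mulmx_continuous.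
rewrite inE /= => r1 rmax; exists r^T; first by rewrite sqn_trmx.
move=> w; have [w0|wN0] := eqVneq (sqn w) 0.
  by rewrite (sqn_eq0 w0) mulmx0 !sqn0 mulr0.
have w_gt0 : 0 < sqn w by rewrite lt_def wN0 sqn_ge0.
pose a := (Num.sqrt (sqn w))^-1.
have a2 : a ^+ 2 = (sqn w)^-1 by rewrite exprVn sqr_sqrtr // sqn_ge0.
have := rmax (a *: w^T); rewrite inE /= sqnZ sqn_trmx a2 mulVf // => /(_ erefl).
rewrite -scalemxAl sqnZ a2 -trmx_mul sqn_trmx ler_pdivrMl //.
by rewrite -[r *m _]trmxK trmx_mul trmxK sqn_trmx mulrC.
Qed.

End SVD.

Section SVDExists.
Variable K : realType.

Lemma lsubmxE m n1 n2 (X : 'M[K]_(m, n1 + n2)) :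
  lsubmx X = X *m col_mx 1%:M 0.
Proof. by rewrite -[X in RHS]hsubmxK mul_row_col mulmx0 addr0 mulmx1. Qed.

Lemma rect_diag_block m n (s : nat -> K) :
  rect_diag (1 + m) (1 + n) s (minn (1 + m) (1 + n)) =
  block_mx (s 0)%:M 0 0 (rect_diag m n (fun i => s i.+1) (minn m n)).
Proof.
apply/matrixP => i j.
case: (split_ordP i) => i' ->; case: (split_ordP j) => j' ->;
  rewrite ?(block_mxEul, block_mxEur, block_mxEdl, block_mxEdr) !mxE /=.
- by rewrite !ord1 !add1n minnSS.
- by case: i' => [[]].
- by case: j' => [[]].
- by rewrite !add1n minnSS ltnS eqSS.
Qed.

(** When the corner entry already equals a bound c for the operator norm, there
    is no room for the rest b of the first row: the vector (c, b^T) would be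
    stretched by more than c. *)
Lemma norm_attaining_border n m (c : K) (b : 'rV[K]_n) (Y : 'M[K]_(m, n)) :
  (forall w : 'cV_(1 + n), sqn (block_mx c%:M b 0 Y *m w) <= c ^+ 2 * sqn w) ->
  b = 0.
Proof.
move=> le_c; apply: sqn_eq0; have := le_c (col_mx c%:M b^T).
rewrite mul_block_col mul0mx add0r !sqn_col_mx sqn_trmx !sqn_scalar.
have -> : (c%:M *m c%:M + b *m b^T) 0 0 = c ^+ 2 + sqn b.
  rewrite -sqn_trmx sqn_tr trmxK [(c%:M *m _ + _) 0 0]mxE -scalar_mxM.
  by rewrite /mxtrace big_ord1 mxE eqxx mulr1n expr2.
rewrite mxE eqxx mulr1n; have := sqn_ge0 b; have := sqn_ge0 (Y *m b^T).
move: (sqn (Y *m _)) (sqn b) => y x y0 x0 le_x.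
have xc0 : 0 <= x * c ^+ 2 by rewrite mulr_ge0 // sqr_ge0.
apply/eqP; rewrite -sqrf_eq0; apply/eqP/le_anti; rewrite sqr_ge0 andbT.
by nra.
Qed.

(** Induction on the dimensions: X maps a unit vector v of maximal image norm
    to c *: u; in orthonormal bases starting with u and v, X becomes
    diag(c, Y) with Y of norm at most c. *)
Lemma svd_exists m n (X : 'M[K]_(m, n)) : exists P s W, is_svd X P s W.
Proof.
have svd0 p q (Z : 'M[K]_(p, q)) : minn p q = 0%N ->
    exists P s W, is_svd Z P s W.
  move=> pq0; exists 1%:M, (fun=> 0), 1%:M; split => //.
  - exact: orthogonal1.
  - exact: orthogonal1.
  by apply/matrixP => i j; have := ltn_ord i; have := ltn_ord j; lia.
elim: m n X => [|m IHm] [|n] X; do ?by apply: svd0; lia.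
change 'M[K]_(1 + m, 1 + n) in X.
have [v v1 vmax] := exists_unit_maximizer X.
pose c := Num.sqrt (sqn (X *m v)).
have c2 : c ^+ 2 = sqn (X *m v) by rewrite sqr_sqrtr ?sqn_ge0.
have [u u1 Xv] : exists2 u : 'cV[K]_(1 + m), sqn u = 1 & X *m v = c *: u.
  have [c0|cN0] := eqVneq c 0.
    exists (col_mx 1%:M 0).
      by rewrite sqn_col_mx sqn0 addr0 sqn_scalar mxE eqxx expr1n.
    by rewrite c0 scale0r; apply: sqn_eq0; rewrite -c2 c0 expr0n.
  exists (c^-1 *: (X *m v)); last by rewrite scalerA divff ?scale1r.
  by rewrite sqnZ -c2 exprVn mulVf // expf_neq0.
have [Hu oHu Hu1] := orthogonal_first_col u1.
have [Hv oHv Hv1] := orthogonal_first_col v1.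
pose M : 'M[K]_(1 + m, 1 + n) := Hu^T *m X *m Hv.
have Mle (w : 'cV_(1 + n)) : sqn (M *m w) <= c ^+ 2 * sqn w.
  rewrite /M -!mulmxA sqn_orthogonall; last exact: orthogonal_trmx.
  by rewrite c2 -(sqn_orthogonall w oHv) vmax.
have lM : lsubmx M = c *: col_mx 1%:M 0.
  rewrite lsubmxE /M -(mulmxA _ Hv) -lsubmxE Hv1 -mulmxA Xv -Hu1 lsubmxE.
  by rewrite -scalemxAr mulmxA oHu mul1mx.
have MB : M = block_mx c%:M (ursubmx M) 0 (drsubmx M).
  have ulE : ulsubmx M = usubmx (lsubmx M).
    by apply/matrixP => i j; rewrite !mxE.
  have dlE : dlsubmx M = dsubmx (lsubmx M).
    by apply/matrixP => i j; rewrite !mxE.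
  rewrite -[LHS]submxK ulE dlE lM !linearZ /= col_mxKu col_mxKd scaler0.
  by rewrite scale_scalar_mx mulr1.
rewrite MB in Mle; have b0 := norm_attaining_border Mle.
rewrite b0 in MB Mle.
have Yle (w : 'cV_n) : sqn (drsubmx M *m w) <= c ^+ 2 * sqn w.
  have := Mle (col_mx 0 w); rewrite mul_block_col !sqn_col_mx !sqn0.
  by rewrite !(mul0mx, mulmx0, add0r, sqn0).
have [P [s [W [oP oW [s0 s_dec] s_out Ydef]]]] := IHm n (drsubmx M).
have s0_le : s 0 <= c.
  have [mn0|mn_gt0] := posnP (minn m n); first by rewrite s_out ?mn0 ?sqrtr_ge0.
  rewrite -ler_sqr ?nnegrE ?sqrtr_ge0 //.
  have n_gt0 : (0 < n)%N by lia.
  have m_gt0 : (0 < m)%N by lia.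
  pose e : 'cV[K]_n := delta_mx (Ordinal n_gt0) 0.
  have e1 : sqn e = 1.
    rewrite sqn_tr trmx_delta mul_delta_mx /mxtrace big_ord1 mxE eqxx.
    by [].
  have := Yle (W *m e); rewrite Ydef -!mulmxA (mulmxA _ W) oW mul1mx.
  rewrite !sqn_orthogonall // e1 mulr1; apply: le_trans.
  rewrite /sqn (bigD1 (Ordinal m_gt0)) //= big_ord1 -colE !mxE eqxx mn_gt0.
  rewrite lerDl; apply: sumr_ge0 => i _; apply: sumr_ge0 => *.
  exact: sqr_ge0.
exists (Hu *m block_mx 1%:M 0 0 P), (fun i => if i is i'.+1 then s i' else c),
  (Hv *m block_mx 1%:M 0 0 W); split.
- by apply: orthogonal_mul => //; apply: orthogonal_block.
- by apply: orthogonal_mul => //; apply: orthogonal_block.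
- split=> [[|i]|[|i] [|j] // ij]; rewrite ?sqrtr_ge0 //; last exact: s_dec.
  by apply: le_trans s0_le; apply: s_dec.
- by case=> [|i]; rewrite minnSS // => ?; apply: s_out.
rewrite [rect_diag _ _ _ _]rect_diag_block.
set B := block_mx c%:M _ _ _.
have MBD : M = block_mx 1%:M 0 0 P *m B *m (block_mx 1%:M 0 0 W)^T.
  rewrite tr_block_mx !mulmx_block !trmx0 trmx1.
  by rewrite !(mul0mx, mulmx0, addr0, add0r, mul1mx, mulmx1) -Ydef.
have XM : X = Hu *m M *m Hv^T.
  rewrite /M !mulmxA (orthogonal_mulmx_tr oHu) mul1mx -mulmxA.
  by rewrite (orthogonal_mulmx_tr oHv) mulmx1.
by rewrite XM MBD trmx_mul !mulmxA.
Qed.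

End SVDExists.

(** * Optimality of truncation (Eckart-Young) and singular values *)

Section EckartYoung.
Variable K : realType.

(** The singular values of the residual of a rank-r truncation; they are not
    shifted, so that they stay attached to the same singular vectors. *)
Definition sv_tail (r : nat) (s : nat -> K) (i : nat) : K :=
  if (i < r)%N then 0 else s i.

Lemma sqn_rect_diag m n p (s : nat -> K) (M : 'M[K]_(n, p)) :
    (forall i, (minn m n <= i)%N -> s i = 0) ->
  sqn (rect_diag m n s (minn m n) *m M) =
  \sum_(j < n) s j ^+ 2 * \sum_k M j k ^+ 2.
Proof.
move=> s_out; set D := rect_diag _ _ _ _.
have DD : D^T *m D = diag_mx (\row_(j < n) s j ^+ 2).
  apply/matrixP => j j'; rewrite !mxE.
  have [jm|mj] := ltnP j m; last first.
    rewrite s_out ?geq_min ?mj // expr0n mul0rn big1 // => i _.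
    rewrite !mxE; have := ltn_ord i.
    by case: eqP => [|_ _]; [lia | rewrite mul0r].
  rewrite (bigD1 (Ordinal jm)) //= big1 ?addr0 => [|i].
    rewrite !mxE /= eqxx leq_min jm ltn_ord /= andbT.
    by rewrite val_eqE; case: eqP => _; rewrite ?mulr1n -?expr2 // mulr0 mulr0n.
  rewrite -val_eqE /= => ij.
  by rewrite !mxE (negbTE ij) mul0r.
rewrite sqn_tr trmx_mul mulmxA -(mulmxA M^T) DD -mulmxA mxtrace_mulC.
rewrite mul_diag_mx; apply: eq_bigr => j _; rewrite mxE mulr_sumr.
by apply: eq_bigr => k _; rewrite !mxE mulrA expr2.
Qed.

Lemma svd_sub_truncated m n (X : 'M[K]_(m, n)) P s W r : is_svd X P s W ->
  X - P *m rect_diag m n s r *m W^T =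
  P *m rect_diag m n (sv_tail r s) (minn m n) *m W^T.
Proof.
case=> _ _ _ _ {1}->; rewrite -mulmxBl -mulmxBr; congr (_ *m _ *m _).
apply/matrixP => i j; rewrite !mxE /sv_tail leq_min.
have := ltn_ord i; have := ltn_ord j.
case: eqP => //= [->|_]; last by rewrite subrr.
by move=> -> ->; case: ifP => _; rewrite ?subrr ?subr0.
Qed.

(** In the two orthonormal bases of the decomposition, the residual of the
    truncation acts diagonally. *)
Lemma svd_tail_sqn m n p (X : 'M[K]_(m, n)) P s W r (M : 'M[K]_(n, p)) :
    is_svd X P s W ->
  sqn ((X - P *m rect_diag m n s r *m W^T) *m M) =
  \sum_(j < n) sv_tail r s j ^+ 2 * \sum_k (W^T *m M) j k ^+ 2.
Proof.
move=> hX; rewrite (svd_sub_truncated r hX); case: hX => oP _ _ s_out _.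
rewrite -!mulmxA sqn_orthogonall // sqn_rect_diag // => i /s_out.
by rewrite /sv_tail; case: ifP.
Qed.

Lemma svd_sqn m n p (X : 'M[K]_(m, n)) P s W (M : 'M[K]_(n, p)) :
    is_svd X P s W ->
  sqn (X *m M) = \sum_(j < n) s j ^+ 2 * \sum_k (W^T *m M) j k ^+ 2.
Proof.
case=> oP _ _ s_out ->; rewrite -!mulmxA sqn_orthogonall // sqn_rect_diag //.
Qed.

Lemma svd_tail_sqn_le m n p (X : 'M[K]_(m, n)) P s W r (M : 'M[K]_(n, p)) :
    is_svd X P s W ->
  sqn ((X - P *m rect_diag m n s r *m W^T) *m M) <= s r ^+ 2 * sqn M.
Proof.
move=> hX; rewrite (svd_tail_sqn _ _ hX); case: hX => _ oW [s0 s_dec] _ _.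
rewrite -(sqn_orthogonall M (orthogonal_trmx oW)) [in leRHS]/sqn mulr_sumr.
apply: ler_sum => j _; apply: ler_wpM2r.
  by apply: sumr_ge0 => *; apply: sqr_ge0.
rewrite /sv_tail; case: ltnP => [_|rj]; first by rewrite expr0n sqr_ge0.
by rewrite ler_sqr ?nnegrE ?s_dec.
Qed.

Lemma rank_truncated m n (P : 'M[K]_m) s (W : 'M[K]_n) r :
  (\rank (P *m rect_diag m n s r *m W^T) <= r)%N.
Proof.
have -> : rect_diag m n s r = rect_diag m r s r *m (pid_mx r : 'M_(r, n)).
  apply/matrixP => i j; rewrite !mxE; have [ir|ri] := ltnP i r; last first.
    by rewrite andbF big1 // => k _; rewrite !mxE ltnNge ri andbF mul0r.
  rewrite (bigD1 (Ordinal ir)) //= !mxE /= eqxx ir andbT big1 ?addr0.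
    by case: eqP => _; rewrite ?mulr1 ?mulr0.
  move=> k; rewrite -val_eqE /= eq_sym => /negbTE ki.
  by rewrite !mxE ki mul0r.
by rewrite mulmxA -mulmxA mulmx_max_rank.
Qed.

Lemma pid_mx_isometry n p : (p <= n)%N ->
  (pid_mx p : 'M[K]_(n, p))^T *m pid_mx p = 1%:M.
Proof.
by move=> pn; rewrite tr_pid_mx mul_pid_mx minnn (minn_idPr pn) pid_mx_1.
Qed.

(** For r < minn m n, some nonzero vector in the span of the first r + 1 right
    singular vectors is killed by B, and X stretches every vector of that span
    at least by the factor s r. *)
Lemma svd_le_of_rank m n (X B : 'M[K]_(m, n)) P s W r c :
    is_svd X P s W -> (\rank B <= r)%N -> 0 <= c ->
    (forall v : 'cV_n, sqn ((X - B) *m v) <= c * sqn v) ->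
  s r ^+ 2 <= c.
Proof.
move=> hX rB c0 le_c; have [oP oW [s0 s_dec] s_out _] := hX.
have [mnr|] := leqP (minn m n) r; first by rewrite s_out // expr0n.
rewrite leq_min => /andP[rm rn].
pose J : 'M[K]_(n, r.+1) := pid_mx r.+1.
have : ~~ row_free (B *m (W *m J))^T.
  rewrite /row_free mxrank_tr neq_ltn; apply/orP; left.
  by rewrite ltnS; apply: leq_trans rB; apply: mxrankM_maxl.
rewrite -kermx_eq0 => /rowV0Pn[x /sub_kermxP xB xN0].
pose v := W *m J *m x^T.
have Bv : B *m v = 0.
  by rewrite /v mulmxA -[_ *m x^T]trmxK trmx_mul trmxK xB trmx0.
have Wv : W^T *m v = J *m x^T by rewrite /v !mulmxA oW mul1mx.
have v_gt0 : 0 < sqn v.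
  rewrite lt_def sqn_ge0 andbT; apply: contraNneq xN0.
  rewrite /v -mulmxA sqn_orthogonall // sqn_mulmx_isometry ?pid_mx_isometry //.
  by rewrite sqn_trmx => /sqn_eq0 ->.
rewrite -(ler_pM2r v_gt0); apply: le_trans (le_c v).
rewrite mulmxBl Bv subr0 (svd_sqn _ hX).
rewrite -(sqn_orthogonall v (orthogonal_trmx oW)) Wv [leLHS]mulr_sumr.
apply: ler_sum => j _; have [jr|rj] := leqP j r.
  apply: ler_wpM2r; first by apply: sumr_ge0 => *; apply: sqr_ge0.
  by rewrite ler_sqr ?nnegrE ?s_dec.
rewrite [X in _ <= _ * X]big1 ?mulr0 ?big1 ?mulr0 // => k _;
  rewrite mxE big1 ?expr0n // => i _; rewrite mxE;
  by rewrite (_ : (j < r.+1)%N = false) ?andbF ?mul0r // ltnNge rj.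
Qed.

(** The right singular vectors of B beyond the r-th lie in its kernel. *)
Lemma rank_le_kernel_basis m n (B : 'M[K]_(m, n)) r : (\rank B <= r)%N ->
  exists2 G : 'M[K]_n, orthogonal_mx G &
    forall i (j : 'I_n), (r <= j)%N -> (B *m G) i j = 0.
Proof.
move=> rB; have [P [s [G hB]]] := svd_exists B.
have [_ oG [s0 s_dec] _ BE] := hB; exists G => // i j rj.
(* B is its own approximation of rank at most r, with zero error. *)
have sr0 : s r = 0.
  apply/eqP; rewrite -sqrf_eq0; apply/eqP/le_anti; rewrite sqr_ge0 andbT.
  by apply: (svd_le_of_rank hB rB) => // v; rewrite subrr mul0mx sqn0 mul0r.
rewrite BE -mulmxA oG mulmx1 mxE big1 // => k _; rewrite mxE.
case: ifP => [/andP[/eqP kj _]|_]; last by rewrite mulr0.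
rewrite (_ : s k = 0) ?mulr0 //.
by apply/le_anti; rewrite s0 andbT -sr0 s_dec // kj.
Qed.

(** On n - r orthonormal vectors of the kernel of B, X - B acts as X does. Hence
    sqn (X - B) is at least a weighted sum of the squared singular values of X,
    with weights c i in [0, 1] of total n - r; such a sum is least when the
    weights sit on the smallest values. *)
Lemma frobenius_truncated_optimal m n (X B : 'M[K]_(m, n)) P s W r :
    is_svd X P s W -> (\rank B <= r)%N ->
  sqn (X - P *m rect_diag m n s r *m W^T) <= sqn (X - B).
Proof.
move=> hX rB; have [_ oW [s0 s_dec] _ _] := hX.
have [G oG BG] := rank_le_kernel_basis rB.
(* J keeps the last n - r columns, on which B *m G vanishes. *)
pose t (j : 'I_n) : K := (r <= j)%:R.
pose J : 'M[K]_n := diag_mx (\row_j t j).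
have mulJ p (Y : 'M[K]_(p, n)) i j : (Y *m J) i j = Y i j * t j.
  by rewrite mul_mx_diag !mxE.
have t2 j : t j ^+ 2 = t j.
  by rewrite /t; case: leqP => _; rewrite ?expr1n ?expr0n.
have BGJ : B *m G *m J = 0.
  apply/matrixP => i j; rewrite mulJ [RHS]mxE /t.
  by case: leqP => rj; rewrite ?mulr0 // BG ?mul0r.
pose O := W^T *m G.
have oO : orthogonal_mx O.
  by apply: orthogonal_mul => //; apply: orthogonal_trmx.
pose c i := \sum_k (O i k) ^+ 2 * t k.
apply: (@le_trans _ _ (\sum_(i < n) s i ^+ 2 * c i)); last first.
  have -> : \sum_(i < n) s i ^+ 2 * c i = sqn ((X - B) *m G *m J).
    rewrite !mulmxBl BGJ subr0 -mulmxA (svd_sqn _ hX) mulmxA.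
    apply: eq_bigr => i _; congr (_ * _); apply: eq_bigr => k _.
    by rewrite mulJ exprMn t2.
  rewrite -(sqn_orthogonalr (X - B) oG).
  apply: ler_sum => i _; apply: ler_sum => j _; rewrite mulJ exprMn t2.
  by rewrite ler_piMr ?sqr_ge0 // /t; case: leqP.
have c_ge0 i : 0 <= c i.
  by apply: sumr_ge0 => k _; rewrite mulr_ge0 ?sqr_ge0 // /t ler0n.
have row1 i : \sum_k (O i k) ^+ 2 = 1.
  have /matrixP/(_ i i) := orthogonal_mulmx_tr oO.
  rewrite mxE [RHS]mxE eqxx mulr1n => <-.
  by apply: eq_bigr => k _; rewrite [O^T _ _]mxE expr2.
have col1 k : \sum_i (O i k) ^+ 2 = 1.
  have /matrixP/(_ k k) := oO; rewrite mxE [RHS]mxE eqxx mulr1n => <-.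
  by apply: eq_bigr => i _; rewrite [O^T _ _]mxE expr2.
have c_le1 i : c i <= 1.
  rewrite -(row1 i); apply: ler_sum => k _.
  by rewrite ler_piMr ?sqr_ge0 // /t; case: leqP.
have sum_c : \sum_i c i = \sum_i t i.
  rewrite exchange_big; apply: eq_bigr => k _.
  by rewrite -mulr_suml col1 mul1r.
rewrite -[X in sqn X]mulmx1 (svd_tail_sqn _ _ hX) mulmx1.
have Wrow i : \sum_k W^T i k ^+ 2 = 1.
  have /matrixP/(_ i i) := oW; rewrite mxE [RHS]mxE eqxx mulr1n => <-.
  by apply: eq_bigr => k _; rewrite !mxE expr2.
have -> : \sum_(i < n) sv_tail r s i ^+ 2 * \sum_k W^T i k ^+ 2 =
          \sum_(i < n) s i ^+ 2 * t i.
  apply: eq_bigr => i _; rewrite Wrow mulr1 /sv_tail /t.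
  by case: ltnP => _; rewrite ?expr0n ?mulr0 ?mulr1.
rewrite -subr_ge0 -sumrB.
(* The weights c and t have the same total, so s r ^+ 2 may be subtracted from
   each s i ^+ 2; as c i lies in [0, 1], both factors of a term then have the
   same sign, whether i is below r or not. *)
have -> : \sum_(i < n) (s i ^+ 2 * c i - s i ^+ 2 * t i) =
          \sum_(i < n) (s i ^+ 2 - s r ^+ 2) * (c i - t i).
  apply/eqP; rewrite -subr_eq0 -sumrB.
  rewrite (eq_bigr (fun i : 'I_n => s r ^+ 2 * (c i - t i)));
    last by move=> i _; ring.
  by rewrite -mulr_sumr sumrB sum_c subrr mulr0.
apply: sumr_ge0 => i _; rewrite /t; case: leqP => ri.
  by rewrite mulr_le0 ?subr_le0 // ler_sqr ?nnegrE ?s_dec.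
by rewrite subr0 mulr_ge0 // subr_ge0 ler_sqr ?nnegrE ?s_dec // ltnW.
Qed.

Lemma singular_valueP m n (X : 'M[K]_(m, n)) : exists P s W,
  is_svd X P s W /\ forall i, singular_value i X = s i.-1.
Proof.
have [P [s [W hX]]] := svd_exists X.
rewrite /singular_value; case: xgetP => [s' _ [P' [W' hX']]|/(_ s) []].
  by exists P', s', W'.
by exists P, W.
Qed.

End EckartYoung.

Section SpectralNorm.
Variable K : realType.

(** The largest singular value bounds the set whose supremum is the spectral
    norm. *)
Lemma spectral_norm_has_sup m n (X : 'M[K]_(m, n)) :
  has_sup [set frobenius_norm (X *m v) |
            v in [set v : 'cV[K]_n | frobenius_norm v <= 1]]%classic.
Proof.
split; first by exists (frobenius_norm (X *m (0 : 'cV_n))), 0 => //=;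
  rewrite /frobenius_norm -/(sqn 0) sqn0 sqrtr0.
have [P [s [W hX]]] := svd_exists X; have [_ _ [s0 _] _ _] := hX.
exists (s 0) => _ [v /= v1 <-].
rewrite -ler_sqr ?nnegrE ?sqrtr_ge0 // frobenius_norm_sqr.
have := svd_tail_sqn_le 0 v hX.
have -> : X - P *m rect_diag m n s 0 *m W^T = X.
  rewrite (_ : rect_diag m n s 0 = 0) ?mulmx0 ?mul0mx ?subr0 //.
  by apply/matrixP => i j; rewrite !mxE andbF.
move/le_trans; apply; rewrite ler_piMr ?sqr_ge0 // -frobenius_norm_sqr.
by rewrite expr_le1 // sqrtr_ge0.
Qed.

Lemma spectral_norm_ge0 m n (X : 'M[K]_(m, n)) : 0 <= spectral_norm X.
Proof.
apply: (sup_upper_bound (spectral_norm_has_sup X)); exists 0 => /=;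
  by rewrite ?mulmx0 /frobenius_norm -/(sqn 0) sqn0 sqrtr0.
Qed.

Lemma sqn_le_spectral_norm m n (X : 'M[K]_(m, n)) (v : 'cV[K]_n) :
  sqn (X *m v) <= spectral_norm X ^+ 2 * sqn v.
Proof.
have [v0|vN0] := eqVneq (sqn v) 0.
  by rewrite (sqn_eq0 v0) mulmx0 !sqn0 mulr0.
have v_gt0 : 0 < sqn v by rewrite lt_def vN0 sqn_ge0.
pose a := (Num.sqrt (sqn v))^-1.
have a2 : a ^+ 2 = (sqn v)^-1 by rewrite exprVn sqr_sqrtr // sqn_ge0.
rewrite mulrC -ler_pdivrMl // -a2 -sqnZ scalemxAr -frobenius_norm_sqr.
rewrite ler_sqr ?nnegrE ?sqrtr_ge0 ?spectral_norm_ge0 //.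
apply: (sup_upper_bound (spectral_norm_has_sup X)); exists (a *: v) => //=.
by rewrite /frobenius_norm -/(sqn _) sqnZ a2 mulVf ?sqrtr1.
Qed.

Lemma spectral_norm_sqr_le m n (X : 'M[K]_(m, n)) c : 0 <= c ->
  (forall v : 'cV_n, sqn (X *m v) <= c * sqn v) -> spectral_norm X ^+ 2 <= c.
Proof.
move=> c0 le_c; rewrite -[leRHS](sqr_sqrtr c0).
rewrite ler_sqr ?nnegrE ?sqrtr_ge0 ?spectral_norm_ge0 //.
apply: ge_sup => [|_ [v /= v1 <-]]; first by case: (spectral_norm_has_sup X).
apply: ler_wsqrtr; apply: le_trans (le_c v) _.
rewrite ler_piMr // -frobenius_norm_sqr.
by rewrite expr_le1 // sqrtr_ge0.
Qed.

Definition contraction m n (C : 'M[K]_(m, n)) :=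
  forall v : 'cV[K]_n, sqn (C *m v) <= sqn v.

Lemma isometry_contraction m n (C : 'M[K]_(m, n)) :
  C^T *m C = 1%:M -> contraction C.
Proof. by move=> CC v; rewrite sqn_mulmx_isometry. Qed.

Lemma contraction_mul m n p (C : 'M[K]_(m, n)) (D : 'M[K]_(n, p)) :
  contraction C -> contraction D -> contraction (C *m D).
Proof. by move=> hC hD v; rewrite -mulmxA (le_trans (hC _)). Qed.

Lemma pid_mx_contraction m n r : contraction (pid_mx r : 'M[K]_(m, n)).
Proof.
move=> v; pose s i : K := (i < minn r (minn m n))%:R.
have -> : pid_mx r = rect_diag m n s (minn m n).
  apply/matrixP => i j; rewrite !mxE /s !leq_min (ltn_ord i) /=.
  have := ltn_ord j; case: eqP => //= -> ->.
  by rewrite andbT.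
rewrite sqn_rect_diag => [|i]; last first.
  by rewrite /s (leq_min _ r) leqNgt => /negbTE ->; rewrite andbF.
apply: ler_sum => j _; apply: ler_piMl.
  by apply: sumr_ge0 => *; apply: sqr_ge0.
by rewrite /s; case: leqP => _; rewrite ?expr0n ?expr1n.
Qed.

(** Compressing the optimal rank-r approximation of X gives a rank-r
    approximation of the compression that is at least as close. *)
Lemma singular_value_contraction m n p q i (X : 'M[K]_(m, n))
    (C : 'M[K]_(p, m)) (D : 'M[K]_(n, q)) :
    contraction C -> contraction D ->
  singular_value i (C *m X *m D) <= singular_value i X.
Proof.
move=> hC hD; have [P [s [W [hX ->]]]] := singular_valueP X.
have [P' [s' [W' [hY ->]]]] := singular_valueP (C *m X *m D).
have [_ _ [s0 _] _ _] := hX; have [_ _ [s'0 _] _ _] := hY.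
rewrite -ler_sqr ?nnegrE //; set r := i.-1.
pose B := P *m rect_diag m n s r *m W^T.
apply: (svd_le_of_rank (B := C *m B *m D) hY) => [||v]; last 1 first.
- rewrite -mulmxBl -mulmxBr -!mulmxA (le_trans (hC _)) //.
  rewrite (le_trans (svd_tail_sqn_le r _ hX)) // ler_wpM2l ?sqr_ge0 //.
- apply: leq_trans (mxrankM_maxl _ _) _; apply: leq_trans (mxrankM_maxr _ _) _.
  exact: rank_truncated.
- exact: sqr_ge0.
Qed.

End SpectralNorm.

(** * Contractions and blockings *)

Section Blocks.
Variable K : realType.

Lemma sqn_sum_col m n (X : 'M[K]_(m, n)) : sqn X = \sum_j sqn (col j X).
Proof.
rewrite /sqn exchange_big; apply: eq_bigr => j _; apply: eq_bigr => i _.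
by rewrite big_ord1 mxE.
Qed.

Lemma contraction_sqn m n p (C : 'M[K]_(m, n)) (X : 'M[K]_(n, p)) :
  contraction C -> sqn (C *m X) <= sqn X.
Proof.
move=> hC; rewrite !sqn_sum_col; apply: ler_sum => j _.
by rewrite !colE -mulmxA.
Qed.

(** Pythagoras: v splits into N *m (N^T *m v) and an orthogonal remainder. *)
Lemma isometry_tr_contraction m n (N : 'M[K]_(m, n)) :
  N^T *m N = 1%:M -> contraction N^T.
Proof.
move=> NN v; have := sqn_ge0 (v - N *m (N^T *m v)).
suff -> : sqn (v - N *m (N^T *m v)) = sqn v - sqn (N^T *m v).
  by rewrite subr_ge0.
set r := v - _.
have Nr : N^T *m r = 0 by rewrite mulmxBr !mulmxA NN mul1mx subrr.
have rE : r^T = v^T - v^T *m N *m N^T.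
  by rewrite /r linearB /= !trmx_mul trmxK.
rewrite sqn_tr rE mulmxBl -(mulmxA _ N^T) Nr mulmx0 subr0.
by rewrite mulmxBr linearB /= !sqn_tr trmx_mul trmxK !mulmxA.
Qed.

Lemma castmx_mulmx m n p m' n' p' (em : m = m') (en : n = n') (ep : p = p')
    (X : 'M[K]_(m, n)) (Y : 'M[K]_(n, p)) :
  castmx (em, ep) (X *m Y) = castmx (em, en) X *m castmx (en, ep) Y.
Proof. by case: m' / em; case: n' / en; case: p' / ep. Qed.

Lemma castmxB m n m' n' (e : (m = m') * (n = n')) (X Y : 'M[K]_(m, n)) :
  castmx e (X - Y) = castmx e X - castmx e Y.
Proof. by case: e => em en; case: m' / em; case: n' / en. Qed.

Lemma castmx_tr m n m' n' (em : m = m') (en : n = n') (X : 'M[K]_(m, n)) :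
  (castmx (em, en) X)^T = castmx (en, em) X^T.
Proof. by case: m' / em; case: n' / en. Qed.

Lemma castmx_scalar m m' (em : m = m') (a : K) :
  castmx (em, em) (a%:M : 'M_m) = a%:M.
Proof. by case: m' / em. Qed.

Lemma split_mxM m n p a b c (ha : (a <= m)%N) (hb : (b <= n)%N)
    (hc : (c <= p)%N) (X : 'M[K]_(m, n)) (Y : 'M[K]_(n, p)) :
  split_mx ha hc (X *m Y) = split_mx ha hb X *m split_mx hb hc Y.
Proof. exact: castmx_mulmx. Qed.

Lemma split_mxK m n a b (ha : (a <= m)%N) (hb : (b <= n)%N) (X : 'M[K]_(m, n)) :
  join_mx ha hb (split_mx ha hb X) = X.
Proof. exact: (castmxKV (subnKC ha) (subnKC hb)). Qed.

Lemma join_mxK m n a b (ha : (a <= m)%N) (hb : (b <= n)%N) X :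
  split_mx ha hb (join_mx ha hb X : 'M[K]_(m, n)) = X.
Proof. exact: (castmxK (subnKC ha) (subnKC hb)). Qed.

(** The last n - p columns of the identity: they embed the space on which the
    trailing block acts. *)
Definition tail_mx p n (hp : (p <= n)%N) : 'M[K]_(n, n - p) :=
  castmx (subnKC hp, erefl) (col_mx 0 1%:M).

Lemma tail_mx_isometry p n (hp : (p <= n)%N) :
  (tail_mx hp)^T *m tail_mx hp = 1%:M.
Proof.
rewrite /tail_mx castmx_tr -castmx_mulmx tr_col_mx mul_row_col.
by rewrite trmx0 trmx1 mul0mx add0r mulmx1 castmx_scalar.
Qed.

Lemma join_mx_block_dr m n a b (ha : (a <= m)%N) (hb : (b <= n)%N)
    (Y : 'M[K]_(m - a, n - b)) :
  join_mx ha hb (block_mx 0 0 0 Y) = tail_mx ha *m Y *m (tail_mx hb)^T.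
Proof.
rewrite /join_mx /tail_mx castmx_tr tr_col_mx trmx0 trmx1.
have -> : block_mx 0 0 0 Y = col_mx 0 1%:M *m Y *m row_mx 0 1%:M
    :> 'M_(a + (m - a), b + (n - b)).
  by rewrite mul_col_mx mul_col_row !(mul0mx, mulmx0, mul1mx, mulmx1).
rewrite (castmx_mulmx _ (erefl _)) (castmx_mulmx _ (erefl _)).
by rewrite [castmx (erefl _, erefl _) Y]castmx_id.
Qed.

Lemma pid_mx_castmx p n (hp : (p <= n)%N) :
  pid_mx p = castmx (subnKC hp, erefl) (col_mx 1%:M 0) :> 'M[K]_(n, p).
Proof.
by rewrite -pid_mx_col; apply/matrixP => i j; rewrite castmxE !mxE.
Qed.

(** [pid_mx b] selects the first b columns, and the shape of X confines these to
    the first a rows. *)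
Lemma mulmx_pid_of_block m n a b (ha : (a <= m)%N) (hb : (b <= n)%N)
    (X : 'M[K]_(m, n)) Y11 Y12 Y22 :
    split_mx ha hb X = block_mx Y11 Y12 0 Y22 ->
  X *m pid_mx b = pid_mx a *m Y11 :> 'M[K]_(m, b).
Proof.
move=> hX; rewrite -(split_mxK ha hb X) hX !pid_mx_castmx /join_mx.
rewrite -castmx_mulmx mul_block_col !mulmx0 !mulmx1 !addr0.
have -> : Y11 = castmx (erefl, erefl) Y11 by rewrite castmx_id.
by rewrite -castmx_mulmx mul_col_mx mul1mx mul0mx castmx_id.
Qed.

Lemma first_colsE p m n (X : 'M[K]_(m, n)) : first_cols p X = X *m pid_mx p.
Proof.
rewrite /first_cols -[X in colsub _ X]mulmx1 -mulmx_colsub; congr (_ *m _).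
apply/matrixP => i j; rewrite !mxE -val_eqE /=.
by case: eqP => //= ->; have := ltn_ord j; rewrite leq_min => /andP[-> _].
Qed.

(** * The Moore-Penrose inverse of a matrix of full column rank *)

(** Both X *m Y and Y *m X are determined by X: each is an orthogonal projection
    with prescribed range. *)
Lemma moore_penrose_unique m n (X : 'M[K]_(m, n)) Y Z :
  is_moore_penrose X Y -> is_moore_penrose X Z -> Y = Z.
Proof.
move=> [XYX YXY XYT YXT] [XZX ZXZ XZT ZXT].
have XYZ : X *m Y = X *m Z.
  by rewrite -XYT -{1}XZX -!mulmxA mulmxA trmx_mul XYT XZT mulmxA XYX.
have YZX : Y *m X = Z *m X.
  by rewrite -YXT -{1}XZX !mulmxA -mulmxA trmx_mul YXT ZXT -mulmxA
    (mulmxA X) XYX.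
by rewrite -YXY YZX -mulmxA XYZ mulmxA ZXZ.
Qed.

Lemma full_rank_gram_unit m n (X : 'M[K]_(m, n)) :
  \rank X = n -> X^T *m X \in unitmx.
Proof.
move=> rX; rewrite -row_free_unit -kermx_eq0; apply/rowV0P => v /sub_kermxP vXX.
have vX : v *m X^T = 0.
  apply: sqn_eq0; rewrite -sqn_trmx sqn_tr trmxK trmx_mul trmxK.
  by rewrite mulmxA -(mulmxA v) vXX mul0mx mxtrace0.
have fX : row_free X^T by rewrite /row_free mxrank_tr rX.
by apply: (row_free_inj fX); rewrite vX mul0mx.
Qed.

(** For full column rank the pseudo-inverse is (X^T X)^-1 X^T. *)
Lemma moore_penroseP m n (X : 'M[K]_(m, n)) :
  \rank X = n -> is_moore_penrose X (moore_penrose X).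
Proof.
move=> rX; have uX := full_rank_gram_unit rX.
rewrite /moore_penrose; case: xgetP => [Y _ //|].
move=> /(_ (invmx (X^T *m X) *m X^T)) [].
have YX : invmx (X^T *m X) *m X^T *m X = 1%:M by rewrite -mulmxA mulVmx.
split; rewrite ?YX ?trmx1 -?(mulmxA X) ?YX ?mul1mx ?mulmx1 //.
by rewrite !trmx_mul trmx_inv trmx_mul !trmxK mulmxA.
Qed.

Lemma moore_penrose_mul1 m n (X : 'M[K]_(m, n)) :
  \rank X = n -> moore_penrose X *m X = 1%:M.
Proof.
move=> rX; have [XYX _ _ _] := moore_penroseP rX.
have uX := full_rank_gram_unit rX.
apply: (can_inj (mulKmx uX)); rewrite mulmx1.
by rewrite -mulmxA (mulmxA X) XYX.
Qed.

Lemma moore_penrose_mulr_unit m n (B : 'M[K]_(m, n)) (C : 'M[K]_n) :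
    C \in unitmx -> \rank (B *m C) = n ->
  moore_penrose B = C *m moore_penrose (B *m C).
Proof.
move=> uC rBC; have [XYX YXY XYT YXT] := moore_penroseP rBC.
have rB : \rank B = n.
  by rewrite -[RHS]rBC mxrankMfree // row_free_unit.
apply: (moore_penrose_unique (moore_penroseP rB)).
have YB : C *m moore_penrose (B *m C) *m B = 1%:M.
  apply: (can_inj (mulmxK uC)); rewrite mul1mx -!mulmxA.
  by rewrite moore_penrose_mul1 // mulmx1.
split; rewrite ?YB ?trmx1 ?mul1mx -?(mulmxA B) ?YB ?mulmx1 //.
by rewrite mulmxA.
Qed.

End Blocks.

(** * The low-rank approximation *)

Section Residual.
Variable K : realType.

(** The generalized Schur complement B22 - B21 B11^+ B12, written as the lower
    block row of B applied to the graph of - B11^+ B12: this form shows at once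
    how its norm is controlled. *)
Definition schur_compl p p2 l m2 (B : 'M[K]_(p + p2, l + m2)) :
    'M[K]_(p2, m2) :=
  dsubmx B *m col_mx (- (moore_penrose (ulsubmx B) *m ursubmx B)) 1%:M.

(** The invertible factor R11 cancels from B21 R11 (B11 R11)^+, so the
    approximation reproduces the first block column exactly and leaves the Schur
    complement of B in the last block. *)
Lemma residual_block p p2 l m2 q2 (B : 'M[K]_(p + p2, l + m2))
    (R11 : 'M[K]_l) (R12 : 'M[K]_(l, q2)) (R22 : 'M[K]_(m2, q2)) :
  let X := B *m block_mx R11 R12 0 R22 in
  \rank (ulsubmx X) = l ->
  X - col_mx 1%:M (dlsubmx X *m moore_penrose (ulsubmx X))
        *m row_mx (ulsubmx X) (ursubmx X) =
  block_mx 0 0 0 (schur_compl B *m R22).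
Proof.
rewrite /schur_compl -[dsubmx B]hsubmxK -/(dlsubmx B) -/(drsubmx B).
rewrite -[B in B *m _]submxK mulmx_block.
move: (ulsubmx B) (ursubmx B) (dlsubmx B) (drsubmx B) => B11 B12 B21 B22 /=.
rewrite !mulmx0 !addr0 block_mxKul block_mxKur block_mxKdl => rX.
have uR : R11 \in unitmx.
  rewrite -row_free_unit /row_free eqn_leq rank_leq_row -{1}rX.
  exact: mxrankM_maxr.
rewrite -[B21 *m R11 *m _]mulmxA -(moore_penrose_mulr_unit uR rX).
have rB : \rank B11 = l by rewrite -[RHS]rX mxrankMfree // row_free_unit.
have B1 := moore_penrose_mul1 rB.
rewrite mul_col_row !mul1mx opp_block_mx add_block_mx !subrr.
rewrite mulmxA -(mulmxA B21) B1 mulmx1 subrr; congr block_mx.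
rewrite mul_row_col mulmx1 mulmxN mulmxDr !mulmxDl mulNmx !mulmxA.
rewrite -(mulmxA B21 _ B11) B1 mulmx1.
by move: (B21 *m R12) => Z; rewrite opprD addrACA subrr add0r addrC.
Qed.

(** Pythagoras on the graph of - B11^+ B12, after dropping the lower block row
    of B, which does not expand norms. *)
Lemma schur_compl_sqn_le p p2 l m2 q (B : 'M[K]_(p + p2, l + m2))
    (Y : 'M[K]_(m2, q)) : contraction (dsubmx B) ->
  sqn (schur_compl B *m Y) <=
  sqn Y + sqn (moore_penrose (ulsubmx B) *m ursubmx B *m Y).
Proof.
move=> hB; rewrite /schur_compl -mulmxA (le_trans (contraction_sqn _ hB)) //.
by rewrite mul_col_mx sqn_col_mx mul1mx mulNmx sqnN addrC.
Qed.

Lemma dsubmx_contraction m1 m2 n (X : 'M[K]_(m1 + m2, n)) :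
  X^T *m X = 1%:M -> contraction (dsubmx X).
Proof.
move=> XX v; rewrite -(sqn_mulmx_isometry v XX) -[X in leRHS]vsubmxK.
by rewrite mul_col_mx sqn_col_mx lerDr sqn_ge0.
Qed.

Lemma split_mx_isometry m a b (ha : (a <= m)%N) (hb : (b <= m)%N)
    (O : 'M[K]_m) : orthogonal_mx O ->
  (split_mx ha hb O)^T *m split_mx ha hb O = 1%:M.
Proof.
by move=> OO; rewrite /split_mx castmx_tr -castmx_mulmx OO castmx_scalar.
Qed.

Lemma split_trig_block m n l (hlm : (l <= m)%N) (hln : (l <= n)%N)
    (R : 'M[K]_(m, n)) : is_trig_mx R^T ->
  split_mx hlm hln R =
  block_mx (ulsubmx (split_mx hlm hln R)) (ursubmx (split_mx hlm hln R)) 0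
    (drsubmx (split_mx hlm hln R)).
Proof.
move=> /is_trig_mxP tR; rewrite -[LHS]submxK; congr block_mx.
apply/matrixP => i j; rewrite !mxE castmxE /=.
have := tR (cast_ord (esym (esym (subnKC hln))) (lshift (n - l) j))
           (cast_ord (esym (esym (subnKC hlm))) (rshift l i)).
rewrite mxE; by apply; rewrite /= ltn_addr // ltn_ord.
Qed.

Lemma truncated_svd_optimal m n (E Eopt B : 'M[K]_(m, n)) r :
  truncated_svd r E Eopt -> (\rank B <= r)%N -> sqn (E - Eopt) <= sqn (E - B).
Proof. by move=> [P [s [W [hE ->]]]]; apply: frobenius_truncated_optimal. Qed.

Lemma truncated_svd_rank m n (Y Yopt : 'M[K]_(m, n)) r :
  truncated_svd r Y Yopt -> (\rank Yopt <= r)%N.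
Proof. by move=> [P [s [W [_ ->]]]]; apply: rank_truncated. Qed.

Lemma singular_value_sqr_le m n i (X B : 'M[K]_(m, n)) c :
    (\rank B <= i.-1)%N -> 0 <= c ->
    (forall v : 'cV_n, sqn ((X - B) *m v) <= c * sqn v) ->
  singular_value i X ^+ 2 <= c.
Proof.
have [P [s [W [hX ->]]]] := singular_valueP X => rB c0.
exact: (svd_le_of_rank hX rB c0).
Qed.

End Residual.

(** The errors P *m (S *m Y) *m N^T, where S is a Schur complement, as a linear
    function of Y: a low-rank approximation of Y provides one of the error. *)

Section SchurError.
Variables (K : realType) (m n p p2 l m2 q2 : nat).
Variables (P : 'M[K]_(m, p2)) (N : 'M[K]_(n, q2)) (B : 'M[K]_(p + p2, l + m2)).
Hypotheses (hP : P^T *m P = 1%:M) (hN : N^T *m N = 1%:M).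
Hypothesis hB : contraction (dsubmx B).

Let W := moore_penrose (ulsubmx B) *m ursubmx B.
Let error (Y : 'M[K]_(m2, q2)) := P *m (schur_compl B *m Y) *m N^T.

Lemma error_sqn_le Y : sqn (error Y) <= sqn Y + sqn (W *m Y).
Proof.
rewrite /error -sqn_trmx trmx_mul trmxK.
rewrite (sqn_mulmx_isometry _ hN) sqn_trmx (sqn_mulmx_isometry _ hP).
exact: schur_compl_sqn_le.
Qed.

Lemma error_mulmx_sqn_le Y (v : 'cV[K]_n) :
  sqn (error Y *m v) <=
  (spectral_norm Y ^+ 2 + spectral_norm (W *m Y) ^+ 2) * sqn v.
Proof.
have -> : error Y *m v = P *m (schur_compl B *m (Y *m (N^T *m v))).
  by rewrite /error !mulmxA.
rewrite (sqn_mulmx_isometry _ hP).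
apply: le_trans (schur_compl_sqn_le _ hB) _; rewrite (mulmxA _ Y) -/W mulrDl.
by apply: lerD; apply: le_trans (sqn_le_spectral_norm _ _) _;
  apply: ler_wpM2l; rewrite ?sqr_ge0 //; apply: isometry_tr_contraction.
Qed.

Lemma errorB Y Z : error (Y - Z) = error Y - error Z.
Proof. by rewrite /error !mulmxBr mulmxBl. Qed.

Lemma rank_error Y : (\rank (error Y) <= \rank Y)%N.
Proof.
apply: leq_trans (mxrankM_maxl _ _) _; apply: leq_trans (mxrankM_maxr _ _) _.
exact: mxrankM_maxr.
Qed.

Lemma error_truncated_frobenius r Y Yopt Eopt :
    truncated_svd r (error Y) Eopt -> truncated_svd r Y Yopt ->
  sqn (error Y - Eopt) <= sqn (Y - Yopt) + sqn (W *m (Y - Yopt)).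
Proof.
move=> hE hY; apply: le_trans (error_sqn_le _); rewrite errorB.
apply: truncated_svd_optimal hE _.
exact: leq_trans (rank_error _) (truncated_svd_rank hY).
Qed.

Lemma error_spectral Y :
  spectral_norm (error Y) ^+ 2 <=
  spectral_norm Y ^+ 2 + spectral_norm (W *m Y) ^+ 2.
Proof.
apply: spectral_norm_sqr_le (error_mulmx_sqn_le Y).
by rewrite addr_ge0 ?sqr_ge0.
Qed.

Lemma error_singular_value j Y Yopt : truncated_svd j.-1 Y Yopt ->
  singular_value j (error Y) ^+ 2 <=
  spectral_norm (Y - Yopt) ^+ 2 + spectral_norm (W *m (Y - Yopt)) ^+ 2.
Proof.
move=> hY; apply: (singular_value_sqr_le (B := error Yopt)).
- exact: leq_trans (rank_error _) (truncated_svd_rank hY).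
- by rewrite addr_ge0 ?sqr_ge0.
- by move=> v; rewrite -errorB error_mulmx_sqn_le.
Qed.

End SchurError.

Theorem proposition2p3 (K : realType) (m n k l l' : nat)
    (hk : (1 <= k)%N) (hkl : (k <= l)%N) (hll' : (l <= l')%N)
    (hln : (l <= n)%N) (hl'm : (l' <= m)%N)
    (A : 'M[K]_(m, n))
    (U U' : 'M[K]_m) (L'11 : 'M[K]_l')
    (V V' : 'M[K]_n) (R'11 : 'M[K]_l)
    (Q : 'M[K]_m) (R : 'M[K]_(m, n))
    (hU' : orthogonal_mx U') (hL'tri : is_trig_mx L'11)
    (hL'inv : L'11 \in unitmx) (hU : U = extend_id hl'm L'11 *m U')
    (hUinv : U \in unitmx)
    (hV' : orthogonal_mx V') (hR'tri : is_trig_mx R'11^T)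
    (hR'inv : R'11 \in unitmx) (hV : V = V' *m extend_id hln R'11)
    (hVinv : V \in unitmx)
    (hQ : orthogonal_mx Q) (hR : is_trig_mx R^T) (hQR : A *m V = Q *m R) :
  let hlm : (l <= m)%N := leq_trans hll' hl'm in
  let Abar := split_mx hl'm hln (U *m A *m V) in
  let Abar11 := ulsubmx Abar in
  let Abar12 := ursubmx Abar in
  let Abar21 := dlsubmx Abar in
  let R11 := ulsubmx (split_mx hlm hln R) in
  let R22 := drsubmx (split_mx hlm hln R) in
  let UQ := split_mx hl'm hlm (U *m Q) in
  let UQ11 := ulsubmx UQ in
  let UQ12 := ursubmx UQ in
  let Ak := invmx U *m
    join_mx hl'm hln
      (col_mx 1%:M (Abar21 *m moore_penrose Abar11) *m row_mx Abar11 Abar12)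
    *m invmx V in
  \rank Abar11 = l ->
  [/\ frobenius_norm (A - Ak) ^+ 2 <=
        frobenius_norm R22 ^+ 2
        + frobenius_norm (moore_penrose UQ11 *m UQ12 *m R22) ^+ 2,
      (forall j : nat, (1 <= j <= minn m n - k)%N ->
       forall (Eopt : 'M[K]_(m, n)) (R22opt : 'M[K]_(m - l, n - l)),
       truncated_svd j.-1 (A - Ak) Eopt -> truncated_svd j.-1 R22 R22opt ->
       frobenius_norm ((A - Ak) - Eopt) ^+ 2 <=
         frobenius_norm (R22 - R22opt) ^+ 2
         + frobenius_norm (moore_penrose UQ11 *m UQ12 *m (R22 - R22opt)) ^+ 2),
      spectral_norm (A - Ak) ^+ 2 <=
        spectral_norm R22 ^+ 2
        + spectral_norm (moore_penrose UQ11 *m UQ12 *m R22) ^+ 2,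
      (forall j : nat, (1 <= j <= minn m n - k)%N ->
       forall R22opt : 'M[K]_(m - l, n - l),
       truncated_svd j.-1 R22 R22opt ->
       singular_value j (A - Ak) ^+ 2 <=
         spectral_norm (R22 - R22opt) ^+ 2
         + spectral_norm (moore_penrose UQ11 *m UQ12 *m (R22 - R22opt)) ^+ 2)
    & (forall i : nat, (1 <= i <= k)%N ->
       [/\ singular_value i (first_cols l' Ak) <= singular_value i Ak,
           singular_value i (first_cols l (Ak *m V')) <= singular_value i Ak
         & singular_value i (first_cols l (Ak *m V')) =
             singular_value i (R11 *m invmx R'11)])].
Proof.
move=> hlm Abar Abar11 Abar12 Abar21 R11 R22 UQ UQ11 UQ12 Ak rA.
have AbarE : Abar = UQ *m block_mx R11 (ursubmx (split_mx hlm hln R)) 0 R22.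
  by rewrite /Abar -mulmxA hQR mulmxA (split_mxM _ hlm) -split_trig_block.
have res : Abar - col_mx 1%:M (Abar21 *m moore_penrose Abar11)
                    *m row_mx Abar11 Abar12 =
           block_mx 0 0 0 (schur_compl UQ *m R22).
  move: rA; rewrite /Abar21 /Abar11 /Abar12 AbarE; exact: residual_block.
pose P := U'^T *m tail_mx K hl'm; pose N := V' *m tail_mx K hln.
have hU'T := orthogonal_trmx hU'.
have hP : P^T *m P = 1%:M.
  rewrite trmx_mul trmxK mulmxA -(mulmxA _ U') orthogonal_mulmx_tr //.
  by rewrite mulmx1 tail_mx_isometry.
have hN : N^T *m N = 1%:M.
  by rewrite trmx_mul mulmxA -(mulmxA _ V'^T) hV' mulmx1 tail_mx_isometry.
(* U and U' have the same last m - l' rows. *)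
have hB : contraction (dsubmx UQ).
  have -> : UQ = block_mx L'11 0 0 1%:M *m split_mx hl'm hlm (U' *m Q).
    rewrite /UQ hU -mulmxA (split_mxM _ hl'm) /extend_id join_mxK.
    by [].
  rewrite -[split_mx _ _ _]vsubmxK mul_block_col !mul0mx add0r mul1mx col_mxKd.
  by apply/dsubmx_contraction/split_mx_isometry/orthogonal_mul.
have hE : A - Ak = P *m (schur_compl UQ *m R22) *m N^T.
  set T := schur_compl UQ *m R22.
  (* Matrices supported on the last block ignore the triangular factors. *)
  have extE : extend_id hl'm L'11 *m join_mx hl'm hln (block_mx 0 0 0 T)
                *m extend_id hln R'11 = join_mx hl'm hln (block_mx 0 0 0 T).
    rewrite /extend_id /join_mx -!castmx_mulmx !mulmx_block.
    by rewrite !(mul0mx, mulmx0, addr0, add0r, mul1mx, mulmx1).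
  have UEV : U *m (A - Ak) *m V = join_mx hl'm hln (block_mx 0 0 0 T).
    rewrite -res /join_mx castmxB -/(join_mx _ _ Abar) split_mxK.
    by rewrite mulmxBr mulmxBl /Ak !mulmxA mulmxV // mul1mx mulmxKV.
  apply: (can_inj (mulKmx hUinv)); apply: (can_inj (mulmxK hVinv)).
  rewrite UEV -extE join_mx_block_dr hU hV /P /N trmx_mul !mulmxA.
  rewrite -(mulmxA _ U' U'^T) orthogonal_mulmx_tr // mulmx1.
  by rewrite -(mulmxA _ V'^T V') hV' mulmx1.
(* N is orthogonal to the first l columns of V', so A - Ak vanishes on them and
   A *m V' may replace Ak *m V'. *)
have hcol : Ak *m V' *m pid_mx l = Q *m pid_mx l *m (R11 *m invmx R'11)
              :> 'M_(m, l).
  have EV' : (A - Ak) *m V' *m pid_mx l = 0 :> 'M_(m, l).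
    rewrite hE /N trmx_mul !mulmxA -(mulmxA _ V'^T) hV' mulmx1.
    rewrite -(mulmxA _ _ (pid_mx l)) /tail_mx castmx_tr pid_mx_castmx.
    by rewrite -castmx_mulmx tr_col_mx mul_row_col trmx0 mul0mx mulmx0 addr0
      castmx_const mulmx0.
  have VR : V' *m pid_mx l *m R'11 = V *m pid_mx l :> 'M_(n, l).
    rewrite hV -!mulmxA; congr (_ *m _); apply/esym.
    by apply: mulmx_pid_of_block; rewrite /extend_id join_mxK.
  have RR : R *m pid_mx l = pid_mx l *m R11 :> 'M_(m, l).
    by apply: mulmx_pid_of_block; apply: split_trig_block.
  apply: (can_inj (mulmxK hR'inv)); rewrite -!mulmxA mulVmx // mulmx1 -RR.
  rewrite (mulmxA Q) -hQR -(mulmxA A) -VR !mulmxA; apply/eqP.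
  rewrite eq_sym -subr_eq0.
  by rewrite -!mulmxBl EV' mul0mx.
split.
- by rewrite !frobenius_norm_sqr hE error_sqn_le.
- move=> j _ Eopt R22opt; rewrite hE !frobenius_norm_sqr => hEo hRo.
  exact: error_truncated_frobenius hEo hRo.
- by rewrite hE error_spectral.
- by move=> j _ R22opt hRo; rewrite hE; apply: error_singular_value.
move=> i _.
have c1 q : contraction (1%:M : 'M[K]_q).
  by apply/isometry_contraction/orthogonal1.
have cV' := isometry_contraction hV'.
split.
- rewrite first_colsE -[Ak in leLHS]mul1mx.
  exact: singular_value_contraction (@pid_mx_contraction _ _ _ _).
- rewrite first_colsE -mulmxA -[Ak in leLHS]mul1mx.
  apply: singular_value_contraction => //.
  exact: contraction_mul (@pid_mx_contraction _ _ _ _).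
(* [first_cols l] lands in [minn l n] columns; [pid_mx l] performs the change of
   index type between these and l columns. *)
have fcE : first_cols l (Ak *m V') =
    Q *m pid_mx l *m (R11 *m invmx R'11) *m (pid_mx l : 'M_(l, minn l n)).
  rewrite first_colsE -hcol -[RHS]mulmxA mul_pid_mx; congr (_ *m _).
  by congr pid_mx; lia.
apply/le_anti/andP; split.
  rewrite fcE; apply: singular_value_contraction => //.
    apply: contraction_mul; first exact: isometry_contraction.
    exact: pid_mx_contraction.
  exact: pid_mx_contraction.
have GE : R11 *m invmx R'11 = (pid_mx l *m Q^T) *m first_cols l (Ak *m V') *m
    (pid_mx l : 'M_(minn l n, l)).
  rewrite fcE -!mulmxA mul_pid_mx (mulmxA Q^T) hQ mul1mx.
  rewrite (_ : minn _ _ = l) ?pid_mx_1 ?mulmx1; last by lia.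
  rewrite mulmxA mul_pid_mx (_ : minn _ _ = l) ?pid_mx_1 ?mul1mx //; lia.
rewrite {1}GE; apply: singular_value_contraction.
  apply: contraction_mul; first exact: pid_mx_contraction.
  exact/isometry_contraction/orthogonal_trmx.
exact: pid_mx_contraction.
Qed.
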